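(* If $E\subseteq\mathbb{Q}^2$ has positive upper Banach density, then $$\{x^2-y^2:(x,y)\in E-E\}=\mathbb{Q}.$$
   Context: For $E\subseteq\mathbb{Q}^2$, $E-E=\{u-v:u,v\in E\}$. Upper Banach density is taken in the discrete amenable group $(\mathbb{Q}^d,+)$ (here $d=2$): for $E\subseteq\mathbb{Q}^d$, $$d^\star(E):=\sup_{(F_n)}\limsup_{n\to\infty}\frac{|E\cap F_n|}{|F_n|},$$ the supremum being over all Følner sequences $(F_n)$ in $\mathbb{Q}^d$, i.e. sequences of nonempty finite sets with $|(g+F_n)\triangle F_n|/|F_n|\to0$ for every $g\in\mathbb{Q}^d$. *)

(* Defs.v *)
From HB Require Import structures.
From mathcomp Require Import all_boot all_order all_algebra.
From mathcomp Require Import finmap.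
From mathcomp Require Import all_classical all_reals all_analysis.

Set Implicit Arguments.
Unset Strict Implicit.
Unset Printing Implicit Defensive.

Import Order.TTheory GRing.Theory Num.Theory.
Import numFieldNormedType.Exports.

Local Open Scope classical_set_scope.
Local Open Scope ring_scope.

Definition difference_set (G : zmodType) (E : set G) : set G :=
  [set u - v | u in E & v in E].

Definition fset_translate (G : zmodType) (g : G) (F : {fset G}) : {fset G} :=
  [fset (g + x)%R | x in F]%fset.

Definition fset_symdiff (G : zmodType) (A B : {fset G}) : {fset G} :=
  ((A `\` B) `|` (B `\` A))%fset.

(* [G] is an abelian group, regarded as discrete. *)
Definition Folner_sequence (R : realType) (G : zmodType) (F : nat -> {fset G})
    : Prop :=
  (forall n, F n != fset0) /\
  (forall g : G,
     (fun n => #|` fset_symdiff (fset_translate g (F n)) (F n)|%:R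
               / #|` F n|%:R : R) @ \oo --> (0 : R)).

Definition relative_density (R : realType) (G : zmodType) (E : set G)
    (F : {fset G}) : R :=
  #|` [fset x in F | x \in E]%fset|%:R / #|` F|%:R.

Definition upper_Banach_density (R : realType) (G : zmodType) (E : set G)
    : \bar R :=
  ereal_sup [set limn_esup (fun n => (relative_density R E (F n))%:E)
            | F in @Folner_sequence R G].

(* Main.v *)
Require Import Defs.
From HB Require Import structures.
From mathcomp Require Import all_boot all_order all_algebra.
From mathcomp Require Import finmap.
From mathcomp Require Import all_classical all_reals all_analysis.
From mathcomp Require Import ring lra.

Import Order.TTheory GRing.Theory Num.Theory.
Import numFieldNormedType.Exports.
Local Open Scope classical_set_scope.
Local Open Scope ring_scope.

Set Implicit Arguments.
Unset Strict Implicit.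
Unset Printing Implicit Defensive.

(** Put [a = x - y] and [b = x + y], so that [x ^ 2 - y ^ 2 = a b]; one has to
find, for every rational [c], a point of the hyperbola [a b = c] in [E - E].  The
origin serves for [c = 0], so let [c <> 0].

A Folner sequence along which [E] has positive density produces a translation
invariant mean [M] on [Q ^ 2] with [M(1_E) > 0], and the numbers
[psi(p) = M(1_E(p + y) 1_E(y))] form a positive definite function of [p] which
vanishes unless [p] belongs to [E - E].  The maps [(a, b) |-> (t a, b / t)],
for nonzero [t], preserve every hyperbola.  The group of nonzero rationals is
amenable ([exists_invariant_mean]), so [psi] can be averaged over these maps;
the average [phi] is still positive definite and still detects the hyperbola,
but now [phi(a, b)] is a function [F(a b)] of the product alone as long as
[a <> 0], and [phi(0, b)] takes the same value for all [b <> 0].  To keep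
honest functions instead of a positive definite form, this is realized by the
mean on pairs [(t, y)] and the functions [f_p (t, y) = 1_E (y + t . p)], with
[phi(p - q)] equal to the mean of [f_p f_q] ([hyperbolic_system]).

Now [F(s)] is the correlation of the fixed function [f_(1, 0)] with
[f_(0, - s)], and the [f_(0, - s)] have constant mutual correlation, so that
differences of disjoint pairs of them are orthogonal.  Bessel's inequality
forces [F] to be nearly constant, with some value [l], outside a bounded set
([hyp_cauchy_at_infinity]).

Take finally points [x_i = (M ^ i, c / M ^ i)] on the hyperbola and points
[z_j = (- (j + 1) L, (j + 1) L)].  When [L] and [M] are large, all the products
of coordinates of [x_i - x_j], [z_i - z_j] (for [i <> j]), [z_j - x_i] and [z_j]
are large.  Hence all these pairs have correlation about [l], and the averages
of the [f_(x_i)] and of the [f_(z_j)] are close in quadratic mean.  They have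
therefore nearly the same correlation with [f_0].  For the [z_j] this is about
[l], which is nearly at least [M(1_E) ^ 2] because [l] is also about the mean of
the square of an average of the [f_(z_j)].  For the [x_i] it is [F(c)].  Thus
[F(c) <> 0], and [E - E] meets the hyperbola. *)

(** * Means on bounded functions *)

Definition bounded (R : realType) (T : Type) (h : T -> R) : Prop :=
  exists C, forall x, `|h x| <= C.

Lemma boundedC (R : realType) (T : Type) (a : R) : bounded (fun _ : T => a).
Proof. by exists `|a|. Qed.

Lemma boundedD (R : realType) (T : Type) (g h : T -> R) :
  bounded g -> bounded h -> bounded (fun x => g x + h x).
Proof.
move=> [C gC] [D hD]; exists (C + D) => x.
by rewrite (le_trans (ler_normD _ _))// lerD.
Qed.

Lemma boundedM (R : realType) (T : Type) (g h : T -> R) :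
  bounded g -> bounded h -> bounded (fun x => g x * h x).
Proof.
move=> [C gC] [D hD]; exists (C * D) => x.
by rewrite normrM ler_pM.
Qed.

Lemma boundedN (R : realType) (T : Type) (g : T -> R) :
  bounded g -> bounded (fun x => - g x).
Proof. by move=> [C gC]; exists C => x; rewrite normrN. Qed.

Lemma bounded_sum (R : realType) (T I : Type) (r : seq I) (g : I -> T -> R) :
  (forall i, bounded (g i)) -> bounded (fun x => \sum_(i <- r) g i x).
Proof.
move=> gb; elim: r => [|i r IHr].
  by under eq_fun do rewrite big_nil; exact: boundedC.
by under eq_fun do rewrite big_cons; exact: boundedD.
Qed.

Lemma bounded_comp (R : realType) (T S : Type) (g : T -> R) (u : S -> T) :
  bounded g -> bounded (fun x => g (u x)).
Proof. by move=> [C gC]; exists C => x. Qed.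

Create HintDb bounded.
#[local] Hint Resolve boundedC boundedD boundedM boundedN bounded_sum bounded_comp
  : bounded.

(** A finitely additive probability on all subsets of [T], given as an integral.
Only bounded functions carry information: an ultralimit of finite averages is
not linear beyond them. *)
Record mean (R : realType) (T : Type) := Mean {
  mean_fun :> (T -> R) -> R;
  mean_linear : forall a g h, bounded g -> bounded h ->
    mean_fun (fun x => a * g x + h x) = a * mean_fun g + mean_fun h;
  mean_ge0 : forall h, bounded h -> (forall x, 0 <= h x) -> 0 <= mean_fun h;
  mean1 : mean_fun (fun=> 1) = 1 }.

Lemma eq_mean (R : realType) (T : Type) (m : mean R T) g h :
  g =1 h -> m g = m h.
Proof. by move=> /funext ->. Qed.

Lemma mean0 (R : realType) (T : Type) (m : mean R T) : m (fun=> 0) = 0.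
Proof.
have := mean_linear m 1 (boundedC T (0 : R)) (boundedC T (0 : R)).
by rewrite (@eq_mean _ _ m _ (fun=> 0)) => [|x]; lra.
Qed.

Lemma meanZ (R : realType) (T : Type) (m : mean R T) a g :
  bounded g -> m (fun x => a * g x) = a * m g.
Proof.
move=> gb; have := mean_linear m a gb (boundedC T (0 : R)).
by rewrite mean0 addr0 => <-; apply: eq_mean => x; rewrite addr0.
Qed.

Lemma mean_cst (R : realType) (T : Type) (m : mean R T) a : m (fun=> a) = a.
Proof.
rewrite -[RHS]mulr1 -(mean1 m) -meanZ; auto with bounded.
by apply: eq_mean => x; rewrite mulr1.
Qed.

Lemma meanD (R : realType) (T : Type) (m : mean R T) g h :
  bounded g -> bounded h -> m (fun x => g x + h x) = m g + m h.
Proof.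
move=> gb hb; have := mean_linear m 1 gb hb.
by rewrite mul1r => <-; apply: eq_mean => x; rewrite mul1r.
Qed.

Lemma meanB (R : realType) (T : Type) (m : mean R T) g h :
  bounded g -> bounded h -> m (fun x => g x - h x) = m g - m h.
Proof.
move=> gb hb; have := mean_linear m (-1) hb gb.
by rewrite mulN1r addrC => <-; apply: eq_mean => x; ring.
Qed.

Lemma mean_sum (R : realType) (T I : Type) (m : mean R T) (r : seq I) g :
  (forall i, bounded (g i)) ->
  m (fun x => \sum_(i <- r) g i x) = \sum_(i <- r) m (g i).
Proof.
move=> gb; elim: r => [|i r IHr].
  by rewrite big_nil -[RHS](mean0 m); apply: eq_mean => x; rewrite big_nil.
rewrite big_cons -IHr -meanD; auto with bounded.
by apply: eq_mean => x; rewrite big_cons.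
Qed.

Lemma ler_mean (R : realType) (T : Type) (m : mean R T) g h :
  bounded g -> bounded h -> (forall x, g x <= h x) -> m g <= m h.
Proof.
move=> gb hb gh; rewrite -subr_ge0 -meanB//; apply: mean_ge0.
  by auto with bounded.
by move=> x; rewrite subr_ge0.
Qed.

Lemma mean_norm_le (R : realType) (T : Type) (m : mean R T) h C :
  (forall x, `|h x| <= C) -> `|m h| <= C.
Proof.
move=> hC; have hb : bounded h by exists C.
rewrite ler_norml -{1}(mean_cst m (- C)) -{2}(mean_cst m C).
by apply/andP; split; apply: ler_mean; auto with bounded;
  move=> x; have := hC x; rewrite ler_norml => /andP[].
Qed.

Lemma bounded_mean (R : realType) (T S : Type) (m : mean R T)
    (h : S -> T -> R) :
  bounded (fun p => h p.1 p.2) -> bounded (fun s => m (h s)).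
Proof.
by move=> [C hC]; exists C => s; apply: mean_norm_le => x; exact: (hC (s, x)).
Qed.

(** The Cauchy-Schwarz inequality, in the only form used below: expand the mean
of [(h - a g) ^ 2] where [a] is the mean of [g h]. *)
Lemma mean_sqr_le (R : realType) (T : Type) (m : mean R T) g h :
  (forall x, `|g x| <= 1) -> bounded h ->
  m (fun x => g x * h x) ^+ 2 <= m (fun x => h x * h x).
Proof.
move=> g1 hb; have gb : bounded g by exists 1.
set a := m (fun x => g x * h x).
have : 0 <= m (fun x => (h x - a * g x) * (h x - a * g x)).
  apply: mean_ge0 => [|x]; last by rewrite -expr2 sqr_ge0.
  by apply: boundedM; auto 6 with bounded.
have -> : m (fun x => (h x - a * g x) * (h x - a * g x)) =
    m (fun x => h x * h x) - 2 * a * a + a ^+ 2 * m (fun x => g x * g x).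
  have hhb : bounded (fun x => h x * h x) by auto with bounded.
  have ghb : bounded (fun x => g x * h x) by auto with bounded.
  have ggb : bounded (fun x => g x * g x) by auto with bounded.
  transitivity (m (fun x => - (2 * a) * (g x * h x) +
      (a ^+ 2 * (g x * g x) + h x * h x))).
    by apply: eq_mean => x; ring.
  by rewrite !mean_linear -/a; auto with bounded; ring.
have : m (fun x => g x * g x) <= 1.
  rewrite -(mean_cst m 1); apply: ler_mean; auto with bounded.
  by move=> x; have := g1 x; rewrite ler_norml => /andP[]; nra.
nra.
Qed.

Lemma sqr_mean_le (R : realType) (T : Type) (m : mean R T) h :
  bounded h -> m h ^+ 2 <= m (fun x => h x * h x).
Proof.
move=> hb; have -> : m h = m (fun x => 1 * h x).
  by apply: eq_mean => x; rewrite mul1r.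
by apply: mean_sqr_le => // x; rewrite normr1.
Qed.

Definition mean_dirac (R : realType) (T : Type) (t : T) : mean R T.
Proof. by exists (fun h => h t). Defined.

Definition mean_pair (R : realType) (S T : Type) (m : mean R S) (m' : mean R T) :
  mean R (S * T).
Proof.
exists (fun h => m (fun s => m' (fun t => h (s, t)))).
- move=> a g h gb hb.
  rewrite -mean_linear.
  + apply: eq_mean => s; rewrite mean_linear//.
    * exact: (bounded_comp (fun t => (s, t)) gb).
    * exact: (bounded_comp (fun t => (s, t)) hb).
  + by apply: (@bounded_mean _ _ _ _ (fun s t => g (s, t))); case: gb => C gC;
      exists C => -[].
  + by apply: (@bounded_mean _ _ _ _ (fun s t => h (s, t))); case: hb => C hC;
      exists C => -[].
- move=> h hb h0; apply: mean_ge0 => [|s].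
    by apply: (@bounded_mean _ _ _ _ (fun s t => h (s, t))); case: hb => C hC;
      exists C => -[].
  by apply: mean_ge0 => //; exact: (bounded_comp (fun t => (s, t)) hb).
- by under eq_mean do rewrite mean1; rewrite mean1.
Defined.

Lemma mean_pairE (R : realType) (S T : Type) (m : mean R S) (m' : mean R T) h :
  mean_pair m m' h = m (fun s => m' (fun t => h (s, t))).
Proof. by []. Qed.

Definition mean_average (R : realType) (T I : Type) (r : seq I)
  (r0 : (0 < size r)%N) (m : I -> mean R T) : mean R T.
Proof.
exists (fun h => (\sum_(i <- r) m i h) / (size r)%:R).
- move=> a g h gb hb.
  under eq_bigr do rewrite mean_linear//.
  by rewrite big_split/= -mulr_sumr; ring.
- by move=> h hb h0; rewrite divr_ge0// sumr_ge0// => i _; exact: mean_ge0.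
- under eq_bigr do rewrite mean1.
  by rewrite big_const_seq count_predT iter_addr_0 divff// pnatr_eq0 -lt0n.
Defined.

(** * Ultralimits of means *)

(** The image of an ultrafilter is an ultrafilter, so it converges in a compact
interval. *)
Lemma ultralimit_cvg (R : realType) (U : set_system nat) (u : nat -> R) C :
  UltraFilter U -> (forall n, `|u n| <= C) -> cvg (u @ U).
Proof.
move=> UU uC.
have FU : UltraFilter (u @ U).
  split=> [|G GF sG]; first exact: fmap_proper_filter.
  apply/seteqP; split => // A GA.
  have [//|UnA] := in_ultra_setVsetC (u @^-1` A) UU.
  case: (@filter_not_empty _ G _).
  by rewrite -(setICr A); apply: filterI => //; exact: sG.
have := @segment_compact R (- C) C; rewrite compact_ultra => /(_ _ FU)[].
  apply: (@filterS _ U _ setT) => [n _|]; last exact: filterT.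
  by rewrite /= in_itv/= -ler_norml.
by move=> l [_ ul]; apply/cvg_ex; exists l.
Qed.

Lemma mean_ultralimit_cvg (R : realType) (T : Type) (U : set_system nat)
    (m : nat -> mean R T) h :
  UltraFilter U -> bounded h -> cvg ((fun n => m n h) @ U).
Proof.
move=> UU [C hC]; apply: (@ultralimit_cvg _ _ _ C) => // n.
exact: mean_norm_le.
Qed.

Definition mean_ultralimit (R : realType) (T : Type) (U : set_system nat)
  (UU : UltraFilter U) (m : nat -> mean R T) : mean R T.
Proof.
exists (fun h => lim ((fun n => m n h) @ U)).
- move=> a g h gb hb.
  apply: cvg_lim => //; under eq_fun do rewrite mean_linear//.
  by apply: cvgD; [apply: cvgMr|]; exact: mean_ultralimit_cvg.
- move=> h hb h0; apply: limr_ge; first exact: mean_ultralimit_cvg.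
  by apply: nearW => n; exact: mean_ge0.
- by apply: lim_near_cst => //; apply: nearW => n; exact: mean1.
Defined.

Lemma mean_ultralimitE (R : realType) (T : Type) (U : set_system nat)
    (UU : UltraFilter U) (m : nat -> mean R T) h :
  mean_ultralimit UU m h = lim ((fun n => m n h) @ U).
Proof. by []. Qed.

Lemma mean_ultralimit_eq (R : realType) (T : Type) (U : set_system nat)
    (UU : UltraFilter U) (m : nat -> mean R T) g h :
  \oo `<=` U -> bounded g -> bounded h ->
  (fun n => m n g - m n h) @ \oo --> (0 : R) ->
  mean_ultralimit UU m g = mean_ultralimit UU m h.
Proof.
move=> ooU gb hb ghcvg; apply/eqP; rewrite -subr_eq0 -meanB//; apply/eqP.
have PU : ProperFilter U by exact: ultra_proper.
rewrite mean_ultralimitE; apply: cvg_lim => //; under eq_fun do rewrite meanB//.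
by move=> A /ghcvg; exact: ooU.
Qed.

Lemma mean_ultralimit_ge (R : realType) (T : Type) (U : set_system nat)
    (UU : UltraFilter U) (m : nat -> mean R T) h a (A : set nat) :
  U A -> bounded h -> (forall n, A n -> a <= m n h) ->
  a <= mean_ultralimit UU m h.
Proof.
move=> UA hb ah; have PU : ProperFilter U by exact: ultra_proper.
rewrite mean_ultralimitE; apply: limr_ge; last by apply: filterS UA.
exact: mean_ultralimit_cvg.
Qed.

Lemma exists_ultrafilter_infty (A : set nat) :
  (forall N, exists2 n, (N <= n)%N & A n) ->
  exists U : set_system nat, [/\ UltraFilter U, \oo `<=` U & U A].
Proof.
move=> Ainf.
have PF : ProperFilter (within A \oo).
  split; last exact: within_filter.
  case=> N _ NA; have [n Nn An] := Ainf N; exact: (NA n).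
have [U [UU sU]] := ultraFilterLemma PF.
exists U; split => //.
  move=> B ooB; apply: sU; rewrite /within/=.
  by apply: filterS ooB.
by apply: sU; exact: withinT.
Qed.

(** * Invariant means for commuting maps *)

(** The average over the points obtained from [x] by applying each map [tau i],
[i] in [l], between [0] and [n] times: for commuting maps, a box in the orbit.
*)
Fixpoint orbit_mean (R : realType) (T I : Type) (tau : I -> T -> T) (n : nat)
    (l : seq I) (x : T) : mean R T :=
  if l is i :: l' then
    @mean_average R T nat (iota 0 n.+1) isT
      (fun k => orbit_mean R tau n l' (iter k (tau i) x))
  else mean_dirac R x.

Lemma orbit_mean_cons (R : realType) (T I : Type) (tau : I -> T -> T) n i l x h :
  orbit_mean R tau n (i :: l) x h =
  (\sum_(0 <= k < n.+1) orbit_mean R tau n l (iter k (tau i) x) h) / n.+1%:R.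
Proof. by rewrite /= size_iota. Qed.

Lemma iter_commute (T : Type) (s t : T -> T) k x :
  (forall y, s (t y) = t (s y)) -> iter k s (t x) = t (iter k s x).
Proof. by move=> st; elim: k => //= k ->. Qed.

Lemma orbit_mean_comp (R : realType) (T I : Type) (tau : I -> T -> T) n l x i h :
  (forall j k y, tau j (tau k y) = tau k (tau j y)) ->
  orbit_mean R tau n l x (h \o tau i) = orbit_mean R tau n l (tau i x) h.
Proof.
move=> tauC; elim: l x => // j l IHl x.
rewrite !orbit_mean_cons; congr (_ / _); apply: eq_bigr => k _.
by rewrite IHl iter_commute.
Qed.

(** In the direction of [i] the average telescopes, so that moving the base
point by [tau i] changes it only at the two ends; the other directions merely
average this estimate, since the maps commute. *)
Lemma orbit_mean_invariant (R : realType) (T : Type) (I : eqType)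
    (tau : I -> T -> T) n l x i (h : T -> R) C :
  (forall j k y, tau j (tau k y) = tau k (tau j y)) ->
  (forall y, `|h y| <= C) -> i \in l ->
  `|orbit_mean R tau n l (tau i x) h - orbit_mean R tau n l x h|
    <= (2 * C) / n.+1%:R.
Proof.
move=> tauC hC; elim: l x => // j l IHl x; rewrite inE => ijl.
rewrite !orbit_mean_cons -mulrBl -sumrB normrM normfV [X in _ / X]ger0_norm//.
rewrite ler_pM2r ?invr_gt0//.
case: (eqVneq i j) ijl => [<- _|_ /= il].
  under eq_bigr do rewrite -iterSr.
  rewrite (telescope_sumr (fun k => orbit_mean R tau n l (iter k (tau i) x) h))//.
  rewrite (le_trans (ler_normB _ _))// mulr2n mulrDl mul1r.
  by apply: lerD; exact: mean_norm_le.
apply: (@le_trans _ _ (\sum_(0 <= k < n.+1) (2 * C) / n.+1%:R)).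
  rewrite (le_trans (ler_norm_sum _ _ _))// ler_sum// => k _.
  by rewrite iter_commute//; exact: IHl.
by rewrite sumr_const_nat subn0 -[leLHS]mulr_natr divfK// pnatr_eq0.
Qed.

(** A Markov-Kakutani argument.  Averaging along orbits of length [n.+1] of the
first [n] maps gives means whose invariance defect under each of these maps is
[O(1 / n)]; an ultralimit is exactly invariant under all of them. *)
Theorem exists_invariant_mean (R : realType) (T : Type) (I : countType)
    (tau : I -> T -> T) (x : T) :
  (forall j k y, tau j (tau k y) = tau k (tau j y)) ->
  exists m : mean R T, forall i h, bounded h -> m (h \o tau i) = m h.
Proof.
move=> tauC.
have [U [UU ooU _]] := @exists_ultrafilter_infty setT
  (fun N => @ex_intro2 _ (fun n => (N <= n)%N) setT N (leqnn N) Logic.I).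
pose l (n : nat) : seq I := pmap choice.unpickle (iota 0 n).
exists (mean_ultralimit UU (fun n => orbit_mean R tau n (l n) x)) => i h hb.
have [C hC] := hb; apply: mean_ultralimit_eq => //.
  exact: (bounded_comp (tau i) hb).
apply/cvgr0Pnorm_le => e e0.
near=> n; rewrite orbit_mean_comp//.
have il : i \in l n.
  rewrite mem_pmap; apply/mapP.
  exists (choice.pickle i); last by rewrite choice.pickleK.
  by rewrite mem_iota add0n; near: n; exact: nbhs_infty_gt.
apply: (le_trans (orbit_mean_invariant _ _ tauC hC il)).
have Cn : 2 * C / e <= n%:R by near: n; exact: nbhs_infty_ger.
rewrite ler_pdivrMr// -ler_pdivrMl// mulrC (le_trans Cn)// ler_nat//.
Unshelve. all: by end_near. Qed.

(** * A translation invariant mean from a Folner sequence *)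

(** Infinitely many indices exceed any number below the upper limit; the ultrafilter
is later chosen to contain the set of these indices. *)
Lemma frequently_gt_limn_esup (R : realType) (u : nat -> R) (a : R) :
  (a%:E < limn_esup (fun n => (u n)%:E))%E ->
  forall N, exists2 n, (N <= n)%N & a < u n.
Proof.
move=> au N; apply: contrapT => noN.
suff : (limn_esup (fun n => (u n)%:E) <= a%:E)%E by rewrite leNgt au.
rewrite /limn_esup limf_esupE.
apply: ereal_inf_le; exists (ereal_sup ((fun n => (u n)%:E) @` [set n | (N <= n)%N])).
  by exists [set n | (N <= n)%N] => //; exists N.
apply: ge_ereal_sup => _ [n /= Nn <-]; rewrite lee_fin leNgt.
by apply/negP => an; apply: noN; exists n.
Qed.

Lemma ler_norm_big_fsetB (R : realType) (G : zmodType) (h : G -> R) C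
    (A B : {fset G}) :
  (forall x, `|h x| <= C) ->
  `|\sum_(x <- A) h x - \sum_(x <- B) h x| <= C * #|` fset_symdiff A B|%:R.
Proof.
move=> hC.
have boundS (S : {fset G}) : `|\sum_(x <- S) h x| <= C * #|` S|%:R.
  rewrite (le_trans (ler_norm_sum _ _ _))//.
  rewrite (le_trans (ler_sum _ (fun x _ => hC x)))//.
  by rewrite big_const_seq count_predT iter_addr_0 -[leLHS]mulr_natr.
have splitS (S S' : {fset G}) : \sum_(x <- S) h x =
    \sum_(x <- (S `&` S')%fset) h x + \sum_(x <- (S `\` S')%fset) h x.
  rewrite (big_fsetID _ (fun x => x \in S'))/=.
  by congr (_ + _); apply: eq_fbigl => x; rewrite !inE// andbC.
rewrite (splitS A B) (splitS B A) fsetIC.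
rewrite /fset_symdiff cardfsU.
rewrite (_ : ((A `\` B) `&` (B `\` A))%fset = fset0); last first.
  by apply/fsetP => x; rewrite !inE; case: (x \in A); case: (x \in B).
rewrite cardfs0 subn0 natrD mulrDr.
rewrite opprD addrACA subrr add0r (le_trans (ler_normB _ _))//.
exact: lerD.
Qed.

(** The mean is an ultralimit of the uniform averages over a Folner sequence,
along an ultrafilter that concentrates on the indices of large relative density.
The Folner condition is exactly translation invariance in the limit. *)
Theorem exists_translation_invariant_mean (R : realType) (G : zmodType)
    (E : set G) :
  (0 < upper_Banach_density R E)%E ->
  exists m : mean R G, 0 < m \1_E /\
    forall g h, bounded h -> m (fun x => h (g + x)) = m h.
Proof.
move=> /ereal_sup_gt[_ [F [F0 Fg] <-] d0].
have [a a0 ad] : exists2 a : R, 0 < a &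
    (a%:E < limn_esup (fun n => (relative_density R E (F n))%:E))%E.
  case: (limn_esup _) d0 => [r| |//] d0.
    exists (r / 2); first by rewrite divr_gt0.
    by rewrite lte_fin; move: d0; rewrite lte_fin => d0; lra.
  by exists 1; rewrite ?ltry.
have [U [UU ooU UA]] :=
  exists_ultrafilter_infty (frequently_gt_limn_esup ad).
have size_gt0 n : (0 < size (enum_fset (F n)))%N by rewrite cardfs_gt0.
pose m n : mean R G := mean_average (size_gt0 n) (@mean_dirac R G).
have indb : bounded (\1_E : G -> R).
  by exists 1 => x; rewrite indicE ger0_norm// lern1; case: (_ \in _).
exists (mean_ultralimit UU m); split.
  apply: (lt_le_trans a0); apply: (mean_ultralimit_ge _ UA indb) => n /ltW an.
  apply: (le_trans an); rewrite /relative_density/= ler_pM2r; last first.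
    by rewrite invr_gt0 ltr0n.
  under eq_bigr do rewrite indicE.
  rewrite -natr_sum ler_nat -sum1_size -big_fset_condE big_mkcond/=.
  by apply: leq_sum => x _; case: (_ \in _).
move=> g h hb; have [C hC] := hb.
apply: mean_ultralimit_eq => //; first exact: (bounded_comp (fun x => g + x) hb).
apply/cvgr0Pnorm_le => e e0.
have C0 : 0 <= C by exact: (le_trans _ (hC 0)).
have C1 : 0 < C + 1 by rewrite ltr_wpDl.
near=> n.
rewrite /m/= -mulrBl normrM normfV [X in _ / X]ger0_norm//.
have -> : \sum_(x <- F n) h (g + x) = \sum_(x <- fset_translate g (F n)) h x.
  by rewrite big_imfset//= => x y _ _ /addrI.
apply: (@le_trans _ _ ((C + 1) * (e / (C + 1)))); last first.
  by rewrite mulrC divfK// gt_eqF.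
apply: (@le_trans _ _
  (C * #|` fset_symdiff (fset_translate g (F n)) (F n)|%:R / #|` F n|%:R)).
  rewrite ler_pM2r ?invr_gt0 ?ltr0n//; exact: ler_norm_big_fsetB.
rewrite -mulrA ler_pM ?divr_ge0// ?ler_wpDr//.
rewrite -[leLHS]ger0_norm ?divr_ge0//; near: n.
by move/cvgr0Pnorm_le : (Fg g); apply; rewrite divr_gt0.
Unshelve. all: by end_near. Qed.

(** * Orthogonality and correlations *)

Lemma ler_sum_cst (R : realType) (N : nat) (a : R) (g : 'I_N -> R) :
  (forall i, a <= g i) -> N%:R * a <= \sum_(i < N) g i.
Proof.
move=> ag; apply: (@le_trans _ _ (\sum_(k < N) a)); last by apply: ler_sum => k _.
by rewrite sumr_const card_ord -[leRHS]mulr_natr mulrC.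
Qed.

Lemma ler_sum_sum_diag (R : realType) (N : nat) (a : 'I_N -> 'I_N -> R) b :
  0 <= b -> (forall i, a i i <= 1) -> (forall i j, i != j -> a i j <= b) ->
  \sum_(i < N) \sum_(j < N) a i j <= N%:R + N%:R ^+ 2 * b.
Proof.
move=> b0 a1 ab.
apply: (@le_trans _ _ (\sum_(i < N) (1 + N%:R * b))); last first.
  by rewrite sumr_const card_ord -[leLHS]mulr_natr; lra.
apply: ler_sum => i _; rewrite (bigD1 i)//=; apply: lerD => //.
apply: (@le_trans _ _ (\sum_(j < N) b)).
  rewrite [leRHS](bigD1 i)//=; rewrite -[leLHS]add0r; apply: lerD => //.
  by apply: ler_sum => j; rewrite eq_sym; exact: ab.
by rewrite sumr_const card_ord -[leLHS]mulr_natr mulrC.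
Qed.

Lemma mean_sum_sum (R : realType) (T : Type) (m : mean R T) (I J : Type)
    (r : seq I) (s : seq J) (g : I -> T -> R) (h : J -> T -> R) :
  (forall i, bounded (g i)) -> (forall j, bounded (h j)) ->
  m (fun x => (\sum_(i <- r) g i x) * (\sum_(j <- s) h j x)) =
  \sum_(i <- r) \sum_(j <- s) m (fun x => g i x * h j x).
Proof.
move=> gb hb.
transitivity (\sum_(i <- r) m (fun x => \sum_(j <- s) g i x * h j x)); last first.
  by apply: eq_bigr => i _; rewrite mean_sum// => j; auto with bounded.
rewrite -mean_sum => [|i]; last first.
  by apply: bounded_sum => j; auto with bounded.
by apply: eq_mean => x; rewrite mulr_suml; under eq_bigr do rewrite mulr_sumr.
Qed.

(** Bessel's inequality. If all correlations were at least [e > 0], the sum of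
the first [N] functions would have correlation at least [N e] with [h], although
the mean of its square is at most [N]. *)
Lemma orthogonal_correlation_le0 (R : realType) (T : Type) (m : mean R T)
    (h : T -> R) (g : nat -> T -> R) e :
  (forall x, `|h x| <= 1) -> (forall k x, `|g k x| <= 1) ->
  (forall k l, k != l -> m (fun x => g k x * g l x) = 0) ->
  (forall k, e <= m (fun x => h x * g k x)) -> e <= 0.
Proof.
move=> h1 g1 gorth eg; rewrite leNgt; apply/negP => e0.
have hb : bounded h by exists 1.
have gb k : bounded (g k) by exists 1.
have bnd n : n%:R * e ^+ 2 <= 1.
  case: n => [|n]; first by rewrite mul0r.
  set N := n.+1; have N0 : (0 : R) < N%:R by rewrite ltr0n.
  have := mean_sqr_le m h1
    (@bounded_sum _ _ _ (index_enum 'I_N) (fun k => g k) gb).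
  rewrite mean_sum_sum//.
  have -> : m (fun x => h x * \sum_(k < N) g k x) =
      \sum_(k < N) m (fun x => h x * g k x).
    rewrite -mean_sum => [|k]; last by auto with bounded.
    by apply: eq_mean => x; rewrite mulr_sumr.
  have le1 : N%:R * e <= \sum_(k < N) m (fun x => h x * g k x).
    exact: ler_sum_cst.
  have le2 : \sum_(k < N) \sum_(l < N) m (fun x => g k x * g l x) <= N%:R.
    have := @ler_sum_sum_diag R N (fun k l => m (fun x => g k x * g l x)) 0.
    rewrite mulr0 addr0; apply => // [k|k l kl]; last first.
      by rewrite gorth.
    rewrite (le_trans (ler_norm _))//; apply: mean_norm_le => x.
    by rewrite normrM mulr_ile1.
  move=> le3.
  have : (N%:R * e) ^+ 2 <= N%:R.
    apply: le_trans le2; apply: le_trans le3.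
    rewrite ler_pXn2r ?nnegrE// ?mulr_ge0 ?(ltW e0)//.
    by rewrite (le_trans _ le1)// mulr_ge0// ltW.
  by rewrite exprMn -[leRHS]mulr1 expr2 -mulrA ler_pM2l.
have e20 : 0 < e ^+ 2 by rewrite exprn_gt0.
have := bnd (Num.bound (e ^- 2)).
rewrite -ler_pdivlMr// mul1r leNgt => /negP; apply.
by apply: archi_boundP; rewrite invr_ge0 ltW.
Qed.

(** * Correlations depending only on the product of the coordinates *)

(** The functions [f p] play the role of the translates of one vector by a
unitary representation of [Q ^ 2], and [phi] is its matrix coefficient,
invariant under the torus preserving the hyperbolas [a b = c]. *)
Record hyperbolic_system (R : realType) (T : Type) (m : mean R T)
    (f : rat * rat -> T -> R) (phi : rat * rat -> R) : Prop := {
  hyp_bound : forall p x, 0 <= f p x <= 1;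
  hyp_corr : forall p q, m (fun x => f p x * f q x) = phi (p - q);
  hyp_torus : forall t a b, t != 0 -> phi (t * a, b / t) = phi (a, b) }.

Lemma hyp_norm (R : realType) (T : Type) (m : mean R T) f phi :
  hyperbolic_system m f phi -> forall p x, `|f p x| <= 1.
Proof. by move=> H p x; have /andP[f0 f1] := hyp_bound H p x; rewrite ger0_norm. Qed.

Lemma hyp_bounded (R : realType) (T : Type) (m : mean R T) f phi :
  hyperbolic_system m f phi -> forall p, bounded (f p).
Proof. by move=> H p; exists 1; exact: hyp_norm H p. Qed.

Lemma hyp_le1 (R : realType) (T : Type) (m : mean R T) f phi :
  hyperbolic_system m f phi -> forall p, phi p <= 1.
Proof.
move=> H p; rewrite -(subr0 p) -(hyp_corr H) (le_trans (ler_norm _))//.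
by apply: mean_norm_le => x; rewrite normrM mulr_ile1// (hyp_norm H).
Qed.

Lemma hyp_generic (R : realType) (T : Type) (m : mean R T) f phi :
  hyperbolic_system m f phi ->
  forall a b, a != 0 -> phi (a, b) = phi (1, a * b).
Proof.
move=> H a b a0; rewrite -[LHS](hyp_torus H a b (t := a^-1)) ?invr_eq0//.
by rewrite mulVf// invrK mulrC.
Qed.

Lemma hyp_axis (R : realType) (T : Type) (m : mean R T) f phi :
  hyperbolic_system m f phi -> forall b, b != 0 -> phi (0, b) = phi (0, 1).
Proof.
move=> H b b0; rewrite -[LHS](hyp_torus H 0 b b0).
by rewrite mulr0 divff.
Qed.

(** With [F s = phi (1, s)]: if [F s - F s'] exceeded [e] for arbitrarily large
[s] and [s'], one could choose infinitely many such pairs without common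
entries. The functions [f (0, - s)] have constant mutual correlation
[phi (0, 1)], so the differences [f (0, - s) - f (0, - s')] would be orthogonal
to one another while all correlating with [f (1, 0)]. *)
Lemma hyp_cauchy_at_infinity (R : realType) (T : Type) (m : mean R T) f phi e :
  hyperbolic_system m f phi -> 0 < e ->
  exists C, forall s s', C < `|s| -> C < `|s'| -> phi (1, s) - phi (1, s') <= e.
Proof.
move=> H e0; apply: contrapT => noC.
have /boolp.choice[sel selP] : forall C, exists p : rat * rat,
    [/\ C < `|p.1|, C < `|p.2| & e < phi (1, p.1) - phi (1, p.2)].
  move=> C; apply: contrapT => noS; apply: noC; exists C => s s' Cs Cs'.
  by rewrite leNgt; apply/negP => es; apply: noS; exists (s, s').
(* [C k] bounds all entries of the pairs of index less than [k], so the pair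
   selected beyond [C k] is new. *)
pose next C := Num.max `|(sel C).1| `|(sel C).2|.
pose C k := iter k next 0.
pose s k := (sel (C k)).1; pose s' k := (sel (C k)).2.
have C_mono : {homo C : k l / (k <= l)%N >-> k <= l}.
  apply: homo_leq => // [y x z|k]; first exact: le_trans.
  by rewrite /C/= /next le_max ltW//; have [] := selP (C k).
have C_lt k l : (k < l)%N -> [/\ `|s k| < `|s l|, `|s k| < `|s' l|,
    `|s' k| < `|s l| & `|s' k| < `|s' l|].
  move=> /C_mono Ckl; have [Csl Csl' _] := selP (C l).
  have [sk s'k] : `|s k| <= C l /\ `|s' k| <= C l.
    by split; apply: le_trans Ckl; rewrite /C/= /next le_max lexx ?orbT.
  by split; [apply: le_lt_trans Csl|apply: le_lt_trans Csl'
    |apply: le_lt_trans Csl|apply: le_lt_trans Csl'].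
have neq k l : k != l ->
    [/\ s k != s l, s k != s' l, s' k != s l & s' k != s' l].
  have normneq (x y : rat) : (`|x| < `|y|) || (`|y| < `|x|) -> x != y.
    by apply: contraTneq => ->; rewrite ltxx.
  by case: ltngtP => // /C_lt[? ? ? ?] _; split; apply: normneq; apply/orP; auto.
have corr (x y : rat) : x != y ->
    m (fun t => f (0, - x) t * f (0, - y) t) = phi (0, 1).
  move=> xy; rewrite (hyp_corr H) (_ : _ - _ = (0, y - x)).
    by rewrite (hyp_axis H)// subr_eq0 eq_sym.
  by congr pair => /=; ring.
have fb := hyp_bounded H.
suff : e <= 0 by rewrite leNgt e0.
apply: (@orthogonal_correlation_le0 _ _ m (f (1, 0))
  (fun k x => f (0, - s k) x - f (0, - s' k) x)) => //.
- exact: hyp_norm H _.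
- move=> k x.
  have /andP[] := hyp_bound H (0, - s k) x.
  have /andP[] := hyp_bound H (0, - s' k) x.
  by rewrite ler_norml => *; apply/andP; split; lra.
- move=> k l /neq[n1 n2 n3 n4].
  transitivity (m (fun x => (f (0, - s k) x * f (0, - s l) x -
      f (0, - s k) x * f (0, - s' l) x) - (f (0, - s' k) x * f (0, - s l) x -
      f (0, - s' k) x * f (0, - s' l) x))).
    by apply: eq_mean => x; ring.
  rewrite !meanB; auto with bounded.
  by rewrite !corr//; ring.
- move=> k; have [_ _ /ltW] := selP (C k).
  rewrite -/(s k) -/(s' k) => /le_trans; apply.
  have corr1 (x : rat) : phi (1, x) = m (fun t => f (1, 0) t * f (0, - x) t).
    by rewrite (hyp_corr H); congr phi; congr pair => /=; ring.
  rewrite !corr1 -meanB; auto with bounded.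
  by rewrite le_eqVlt; apply/orP; left; apply/eqP/eq_mean => x; ring.
Qed.

(** * Points whose differences lie on far hyperbolas *)

Lemma diagonal_separated (L : rat) (i j : nat) : 1 <= L -> i != j ->
  L <= `|(- (i.+1%:R * L) - - (j.+1%:R * L)) * (i.+1%:R * L - j.+1%:R * L)|.
Proof.
move=> L1 ij; have L0 : 0 <= L by lra.
have -> : (- (i.+1%:R * L) - - (j.+1%:R * L)) * (i.+1%:R * L - j.+1%:R * L) =
    - (((i%:R - j%:R) * L) ^+ 2) by rewrite -[i.+1]addn1 -[j.+1]addn1 !natrD; ring.
rewrite normrN normrX normrM (ger0_norm L0).
have a1 : 1 <= `|i%:R - j%:R : rat|.
  wlog ji : i j ij / (j < i)%N => [hw|].
    move: (ij); rewrite neq_ltn => /orP[ltij|]; last exact: hw.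
    by rewrite distrC; apply: hw; rewrite // eq_sym.
  by rewrite -natrB ?(ltnW ji)// normr_nat ler1n subn_gt0.
move: a1; set a := `|_| => a1.
have a2 : 1 <= a ^+ 2 by nra.
have L2 : L <= L ^+ 2 by nra.
nra.
Qed.

(** The points of [diagonal_separated] have a negative first and a positive
second coordinate, which makes the first factor at least [L] in absolute value
without any cancellation. *)
Lemma diagonal_hyperbola_separated (L x c : rat) (j : nat) :
  1 <= L -> 1 <= x -> `|c| < L ->
  L - `|c| <= `|(- (j.+1%:R * L) - x) * (j.+1%:R * L - c / x)|.
Proof.
move=> L1 x1 cL; set y := j.+1%:R * L.
have yL : L <= y by rewrite ler_peMl ?ler1n//; lra.
have x0 : 0 < x by lra.
have cx : `|c / x| <= `|c|.
  by rewrite normrM ler_piMr// normfV (gtr0_norm x0) invf_le1.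
have : c / x <= `|c| by rewrite (le_trans (ler_norm _)).
rewrite -opprD normrM normrN => cxc.
rewrite (@ger0_norm _ (y + x)) ?(@ger0_norm _ (y - _)); try lra.
nra.
Qed.

(** With [r = M ^ (j - i)] the product of the coordinates is, up to sign,
[c (r - 1) ^ 2 / r], and [(r - 1) ^ 2 / r >= r - 2]. *)
Lemma hyperbola_separated (M c : rat) (i j : nat) : 2 <= M -> i != j ->
  `|c| * (M - 2) <= `|(M ^+ i - M ^+ j) * (c / M ^+ i - c / M ^+ j)|.
Proof.
move=> M2; wlog ij : i j / (i < j)%N => [hw|_].
  rewrite neq_ltn => /orP[ij|ji]; first by apply: hw => //; rewrite ltn_eqF.
  have -> : (M ^+ i - M ^+ j) * (c / M ^+ i - c / M ^+ j) =
    (M ^+ j - M ^+ i) * (c / M ^+ j - c / M ^+ i) by ring.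
  by apply: hw; rewrite // ltn_eqF.
have M0 : 0 < M by lra.
have [k ->] : exists k, j = (i + k.+1)%N
  by exists (j - i.+1)%N; rewrite -addSnnS subnKC.
set u := M ^+ i; set r := M ^+ k.+1; rewrite exprD -/u -/r.
have u0 : u != 0 by rewrite expf_neq0// gt_eqF.
have Mr : M <= r by rewrite /r exprS ler_peMr ?exprn_ege1//; lra.
have r0 : 0 < r by lra.
have -> : (u - u * r) * (c / u - c / (u * r)) = - (c * ((r - 1) ^+ 2 / r)).
  by field; rewrite u0 gt_eqF.
rewrite normrN normrM ler_wpM2l// (le_trans _ (ler_norm _))//.
rewrite ler_pdivlMr//; nra.
Qed.

(** * The hyperbola is hit *)

(** Suppose that [phi] vanishes on the hyperbola. Let [Z] and [X] be the sums of
the [f (z j)] and of the [f (x i)] over [N] indices. All mutual correlations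
being within [e] of one number [l], the mean of [(Z - X) ^ 2] is at most
[2 N + 4 N ^ 2 e]; yet [Z - X] correlates with [f 0] as much as [Z] does, that
is at least [N (l - e)]. Since the mean of [Z] is at least [N d], also
[d ^ 2 <= l + 2 e], and the two estimates conflict for small [e]. *)
Theorem hyperbolic_system_neq0 (R : realType) (T : Type) (m : mean R T) f phi
    (d : R) (c : rat) :
  hyperbolic_system m f phi -> 0 < d -> (forall p, d <= m (f p)) ->
  exists a b, a * b = c /\ phi (a, b) != 0.
Proof.
move=> H d0 fd; have fb := hyp_bounded H.
have [->|c0] := eqVneq c 0.
  exists 0, 0; rewrite mul0r; split => //.
  rewrite gt_eqF// -[(0, 0)]/(0 - 0 : rat * rat) -(hyp_corr H).
  apply: lt_le_trans (sqr_mean_le m (fb 0)).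
  by rewrite exprn_gt0// (lt_le_trans d0).
apply: contrapT => noab.
have phi0 a b : a * b = c -> phi (a, b) = 0.
  move=> abc; apply: contrapT => /eqP phiab; apply: noab.
  by exists a, b.
have d1 : d <= 1.
  rewrite -(mean_cst m 1); apply: (le_trans (fd 0)).
  apply: ler_mean; [exact: fb|exact: boundedC|move=> x].
  by have /andP[] := hyp_bound H 0 x.
(* With [N e >= 1] the estimates read [(l - e) ^ 2 <= 6 e] and
   [d ^ 2 - 3 e <= l - e]; here [6 e = d ^ 4 / 4], whereas [d <= 1] gives
   [d ^ 2 - 3 e >= 7 / 8 d ^ 2]. *)
pose e := d ^+ 4 / 24.
have e0 : 0 < e by rewrite divr_gt0// exprn_gt0.
have [C' C'P] := hyp_cauchy_at_infinity H e0.
pose C := `|C'|; pose l := phi (1, C + 1).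
have Cge0 : 0 <= C := normr_ge0 _.
have near_l p : C < `|p.1 * p.2| -> l - e <= phi p <= l + e.
  case: p => a b /= Cab.
  have C'C : C' <= C := ler_norm _.
  have a0 : a != 0 by apply: contraTneq Cab => ->; rewrite mul0r normr0 -leNgt.
  rewrite (hyp_generic H)//.
  have h1 : C' < `|a * b| by apply: le_lt_trans Cab.
  have h2 : C' < `|C + 1| by rewrite ger0_norm; lra.
  have := C'P _ _ h1 h2; have := C'P _ _ h2 h1; rewrite -/l => *.
  by apply/andP; split; lra.
pose L := C + `|c| + 1; pose M := 2 + (C + 1) / `|c|.
have c1 : 0 < `|c| by rewrite normr_gt0.
have L1 : 1 <= L by rewrite /L; lra.
have M2 : 2 <= M by rewrite lerDl divr_ge0//; lra.
pose x (i : nat) : rat * rat := (M ^+ i, c / M ^+ i).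
pose z (j : nat) : rat * rat := (- (j.+1%:R * L), j.+1%:R * L).
have Mi i : 1 <= M ^+ i by rewrite exprn_ege1//; lra.
have xx i j : i != j -> phi (x i - x j) <= l + e.
  move=> ij; suff /near_l/andP[//] : C < `|(x i - x j).1 * (x i - x j).2|.
  apply: lt_le_trans (hyperbola_separated c M2 ij).
  by rewrite /M addrC addKr mulrC divfK ?gt_eqF//; lra.
have zz i j : i != j -> phi (z i - z j) <= l + e.
  move=> ij; suff /near_l/andP[//] : C < `|(z i - z j).1 * (z i - z j).2|.
  by apply: lt_le_trans (diagonal_separated L1 ij); rewrite /L; lra.
have zx i j : l - e <= phi (z j - x i).
  suff /near_l/andP[//] : C < `|(z j - x i).1 * (z j - x i).2|.
  apply: lt_le_trans (diagonal_hyperbola_separated j L1 (Mi i) _);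
    by rewrite /L; lra.
have z0 j : l - e <= phi (0 - z j).
  suff /near_l/andP[//] : C < `|(0 - z j).1 * (0 - z j).2|.
  rewrite /= !sub0r opprK mulrN normrN -expr2 normrX ger0_norm; last first.
    by rewrite mulr_ge0//; lra.
  have jL : L <= j.+1%:R * L by rewrite ler_peMl ?ler1n//; lra.
  have CL : C < L by rewrite /L; lra.
  nra.
have x0 i : phi (0 - x i) = 0.
  apply: (phi0 (0 - M ^+ i) (0 - c / M ^+ i)); rewrite !sub0r mulrNN mulrC divfK//.
  by rewrite gt_eqF//; have := Mi i; lra.
pose N := (Num.bound e^-1).+1.
have N0 : (0 : R) < N%:R by rewrite ltr0n.
have Ne : 1 <= N%:R * e.
  have : e^-1 <= N%:R.
    by rewrite ltW// (lt_trans (archi_boundP _))// ?ltr_nat// invr_ge0 ltW.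
  by rewrite -div1r ler_pdivrMr.
set NR : R := N%:R in N0 Ne.
pose X t := \sum_(i < N) f (x i) t; pose Z t := \sum_(j < N) f (z j) t.
have Xb : bounded X by apply: bounded_sum => i.
have Zb : bounded Z by apply: bounded_sum => i.
have le0 : 0 <= l + e.
  apply: le_trans (xx 0 1 isT); rewrite -(hyp_corr H); apply: mean_ge0.
    by auto with bounded.
  move=> t; have /andP[? _] := hyp_bound H (x 0) t.
  by have /andP[? _] := hyp_bound H (x 1) t; rewrite mulr_ge0.
have XX : m (fun t => X t * X t) <= NR + NR ^+ 2 * (l + e).
  rewrite mean_sum_sum//; under eq_bigr do under eq_bigr do rewrite (hyp_corr H).
  apply: ler_sum_sum_diag => // [i|i j ij]; first exact: hyp_le1 H _.
  exact: xx.
have ZZ : m (fun t => Z t * Z t) <= NR + NR ^+ 2 * (l + e).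
  rewrite mean_sum_sum//; under eq_bigr do under eq_bigr do rewrite (hyp_corr H).
  apply: ler_sum_sum_diag => // [i|i j ij]; first exact: hyp_le1 H _.
  exact: zz.
have ZX : NR ^+ 2 * (l - e) <= m (fun t => Z t * X t).
  rewrite mean_sum_sum//; under eq_bigr do under eq_bigr do rewrite (hyp_corr H).
  rewrite expr2 -mulrA; apply: ler_sum_cst => j; apply: ler_sum_cst => i.
  exact: zx.
have Zd : (NR * d) ^+ 2 <= m (fun t => Z t * Z t).
  have NZ : NR * d <= m Z by rewrite mean_sum//; apply: ler_sum_cst => j.
  have NRd : 0 <= NR * d by rewrite mulr_ge0// ltW.
  by apply: le_trans (sqr_mean_le m Zb); rewrite ler_pXn2r ?nnegrE// (le_trans NRd).
pose D t := Z t - X t.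
have Db : bounded D by rewrite /D; auto with bounded.
have f0D : NR * (l - e) <= m (fun t => f 0 t * D t).
  rewrite (_ : m _ = m (fun t => f 0 t * Z t) - m (fun t => f 0 t * X t)); last first.
    rewrite -meanB; auto with bounded.
    by apply: eq_mean => t; rewrite /D mulrBr.
  rewrite (_ : m (fun t => f 0 t * X t) = 0) ?subr0.
    rewrite (_ : m _ = \sum_(j < N) phi (0 - z j)); first exact: ler_sum_cst.
    under eq_bigr do rewrite -(hyp_corr H).
    rewrite -mean_sum => [|j]; last by auto with bounded.
    by apply: eq_mean => t; rewrite mulr_sumr.
  transitivity (\sum_(i < N) phi (0 - x i)); last first.
    by apply: big1 => i _.
  under [RHS]eq_bigr do rewrite -(hyp_corr H).
  rewrite -mean_sum => [|j]; last by auto with bounded.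
  by apply: eq_mean => t; rewrite mulr_sumr.
have DD : m (fun t => D t * D t) <= 2 * NR + 4 * (NR ^+ 2 * e).
  have -> : m (fun t => D t * D t) = m (fun t => Z t * Z t)
      - m (fun t => Z t * X t) - (m (fun t => Z t * X t) - m (fun t => X t * X t)).
    rewrite -!meanB; auto with bounded.
    by apply: eq_mean => t; rewrite /D; ring.
  lra.
have := mean_sqr_le m (hyp_norm H 0) Db => fD.
have NNe : NR <= NR ^+ 2 * e by rewrite expr2 -mulrA ler_peMr// ltW.
have NR2 : 0 < NR ^+ 2 by rewrite exprn_gt0.
have l1 : d ^+ 2 <= l + 2 * e.
  rewrite -(ler_pM2l NR2) -exprMn; apply: (le_trans Zd); apply: (le_trans ZZ).
  lra.
have d2 : d ^+ 4 <= d ^+ 2 by rewrite ler_wiXn2l// ltW.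
have d20 : 0 < d ^+ 2 by rewrite exprn_gt0.
have led : 7 / 8 * d ^+ 2 <= l - e by move: l1 d2 d20; rewrite /e; lra.
have : (l - e) ^+ 2 <= 6 * e.
  rewrite -(ler_pM2l NR2) -exprMn; apply: le_trans (_ : _ <= m (fun t => D t * D t)) _.
    apply: le_trans fD; rewrite ler_pXn2r// nnegrE ?(le_trans _ f0D)// mulr_ge0//;
      by [exact: ltW|lra].
  rewrite (le_trans DD)//; lra.
have : (7 / 8 * d ^+ 2) ^+ 2 <= (l - e) ^+ 2.
  by rewrite ler_pXn2r// nnegrE; lra.
have : 0 < d ^+ 4 by rewrite exprn_gt0.
have -> : (7 / 8 * d ^+ 2) ^+ 2 = 49 / 64 * d ^+ 4 by field.
rewrite /e; lra.
Qed.

(** * From sets of positive density to correlations *)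

(** The map [(a, b) |-> (t a, b / t)], followed by the change of coordinates
from [(a, b) = (x - y, x + y)] to [(x, y)]. *)
Definition torus_act (t : rat) (p : rat * rat) : rat * rat :=
  ((t * p.1 + p.2 / t) / 2, (p.2 / t - t * p.1) / 2).

Lemma torus_actB t p q : torus_act t p - torus_act t q = torus_act t (p - q).
Proof. by case: p q => [a b] [a' b']; congr pair => /=; ring. Qed.

Lemma torus_act_hyperbola t p : t != 0 ->
  (torus_act t p).1 ^+ 2 - (torus_act t p).2 ^+ 2 = p.1 * p.2.
Proof. by move=> t0; rewrite /=; field. Qed.

(** The mean lives on pairs [(t, y)] of a nonzero rational and a point of the
plane. Translation invariance in [y] makes the correlation of [f p] and [f q]
depend on [p - q] only; dilation invariance in [t] gives the torus invariance.
*)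
Lemma exists_hyperbolic_system (R : realType) (E : set (rat * rat)) :
  (0 < upper_Banach_density R E)%E ->
  exists (T : Type) (m : mean R T) f phi (d : R),
    [/\ hyperbolic_system m f phi, 0 < d, forall p, d <= m (f p) &
      forall a b, phi (a, b) != 0 ->
        exists2 z, difference_set E z & z.1 ^+ 2 - z.2 ^+ 2 = a * b].
Proof.
move=> /exists_translation_invariant_mean[M [ME Minv]].
pose Q := {t : rat | t != 0}.
pose mul (s t : Q) : Q := exist _ (sval s * sval t) (mulf_neq0 (svalP s) (svalP t)).
have mulC (s t u : Q) : mul s (mul t u) = mul t (mul s u).
  by apply: val_inj => /=; rewrite mulrCA.
have [mu muinv] := exists_invariant_mean R (exist _ 1 (oner_neq0 _) : Q) mulC.
have indb S (u : S -> rat * rat) : bounded (fun y => \1_E (u y) : R).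
  by exists 1 => y; rewrite indicE ger0_norm// lern1; case: (_ \in _).
pose f (p : rat * rat) (ty : Q * (rat * rat)) : R :=
  \1_E (torus_act (sval ty.1) p + ty.2).
pose psi (p : rat * rat) : R := M (fun y => \1_E (p + y) * \1_E y).
pose phi p := mu (fun t => psi (torus_act (sval t) p)).
exists (Q * (rat * rat))%type, (mean_pair mu M), f, phi, (M \1_E).
split => //.
- split.
  + by move=> p ty; rewrite /f indicE ler0n lern1; case: (_ \in _).
  + move=> p q; rewrite mean_pairE; apply: eq_mean => t; rewrite /psi -torus_actB.
    rewrite -[RHS](Minv (torus_act (sval t) q)); last first.
      by apply: boundedM; exact: indb.
    by apply: eq_mean => y; rewrite /f/= addrA subrK.
  + move=> t a b t0.
    rewrite -[RHS](muinv (exist _ t t0)).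
      apply: eq_mean => s; congr psi; rewrite /torus_act/= -!mulrA [t^-1 * _]mulrC.
      by rewrite -invfM !mulrA ![sval s * t]mulrC.
    apply: (@bounded_mean _ _ _ M (fun (s : Q) y =>
      \1_E (torus_act (sval s) (a, b) + y) * \1_E y)).
    apply: boundedM; first exact: (@indb _ (fun q : Q * (rat * rat) => _)).
    exact: (@indb _ (fun q : Q * (rat * rat) => _)).
- move=> p; rewrite mean_pairE le_eqVlt; apply/orP; left; apply/eqP.
  rewrite -[LHS](mean_cst mu); apply: eq_mean => t.
  by rewrite -[LHS](Minv (torus_act (sval t) p)).
- move=> a b; apply: contraNP => noz.
  rewrite /phi -(mean0 mu); apply/eqP/eq_mean => t.
  rewrite /psi -(mean0 M); apply/eq_mean => y.
  rewrite !indicE; case: (boolP (_ \in E)) => [/set_mem Ety|_]; last by rewrite mul0r.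
  case: (boolP (_ \in E)) => [/set_mem Ey|_]; last by rewrite mulr0.
  case: noz; exists (torus_act (sval t) (a, b)).
    by exists (torus_act (sval t) (a, b) + y) => //; exists y => //; rewrite addrK.
  exact: torus_act_hyperbola (svalP t).
Qed.

Theorem corollary1p14 (R : realType) (E : set (rat * rat)%type)
    (hE : (0 < upper_Banach_density R E)%E) :
  [set z.1 ^+ 2 - z.2 ^+ 2 | z in difference_set E] = [set: rat].
Proof.
apply/seteqP; split => // c _.
have [T [m [f [phi [d [H d0 fd hits]]]]]] := exists_hyperbolic_system hE.
have [a [b [<- phi0]]] := hyperbolic_system_neq0 c H d0 fd.
have [z Ez zE] := hits a b phi0.
by exists z.
Qed.
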